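(* Let $(X,c_X)$ be a Čech closure space with an interior cover $\mathcal{U}=\{U_1,U_2\}$. Let $U_{12}=U_1\cap U_2$, and suppose that $U_1$, $U_2$ and $U_{12}$ are path-connected and that the point $*$ belongs to $U_{12}$. Let $i_\alpha:U_{12}\to U_\alpha$ and $j_\alpha:U_\alpha\to X$ ($\alpha=1,2$) denote the inclusions. Then the square $$\begin{array}{ccc}\pi_1(U_{12},* )&\xrightarrow{\pi_1(i_1)}&\pi_1(U_1,* )\\ {\scriptstyle\pi_1(i_2)}\downarrow&&\downarrow{\scriptstyle\pi_1(j_1)}\\ \pi_1(U_2,* )&\xrightarrow{\pi_1(j_2)}&\pi_1(X,* )\end{array}$$ is a pushout in the category of groups.
   Context: A Čech closure space $(X,c)$ is a set $X$ with a map $c:\mathcal{P}(X)\to\mathcal{P}(X)$ such that $c(\emptyset)=\emptyset$, $A\subseteq c(A)$, and $c(A\cup B)=c(A)\cup c(B)$; it is not assumed that $c^2=c$. A topological space is a closure space via its topological closure. A map $f:(X,c_X)\to(Y,c_Y)$ is continuous iff $f(c_X(A))\subseteq c_Y(f(A))$ for all $A\subseteq X$. $U$ is a neighborhood of $x$ if $x\in X\setminus c(X\setminus U)$. An interior cover of $(X,c)$ is a family of subsets such that every point $x\in X$ has a neighborhood belonging to the family. A subset $A\subseteq X$ carries the subspace closure $c_A(B)=A\cap c(B)$. The product closure structure on $X\times Y$ is the one in which, at each point $(x,y)$, the sets $V\times W$ ($V$ a neighborhood of $x$, $W$ a neighborhood of $y$) form a local base of neighborhoods. $I=[0,1]$ has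 its usual topology. $\pi_1(X,* )$ is the group of homotopy classes rel $\partial I$ of continuous loops $v:I\to(X,c)$ with $v(0)=v(1)=*$ (homotopies are continuous maps $I\times I\to(X,c)$ fixed on $\partial I$), with product $[v][w]=[v\star w]$, where $v\star w$ is the concatenation ''first $v$, then $w$''. Path-connectedness refers to continuous paths from $I$. Subsets carry the subspace closure. *)

(* Defs.v *)
From HB Require Import structures.
From mathcomp Require Import all_boot all_order all_algebra generic_quotient.
From mathcomp Require Import all_classical all_reals topology.
From mathcomp Require Import normedtype.
From mathcomp Require Import ring lra.

Set Implicit Arguments.
Unset Strict Implicit.
Unset Printing Implicit Defensive.

Import Order.TTheory GRing.Theory Num.Theory.
Import numFieldNormedType.Exports.

Local Open Scope classical_set_scope.
Local Open Scope ring_scope.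
Local Open Scope quotient_scope.

(* Bundled rather than declared with HB: the same carrier (e.g. a subset of a
   topological space) would otherwise receive competing canonical closures. *)
Record closureSpace := ClosureSpace {
  cs_sort :> Type ;
  cl : set cs_sort -> set cs_sort ;
  cl0 : cl set0 = set0 ;
  sub_cl : forall A, A `<=` cl A ;
  clU : forall A B, cl (A `|` B) = cl A `|` cl B }.

Definition ccontinuous (X Y : closureSpace) (f : X -> Y) : Prop :=
  forall A : set X, f @` (cl A) `<=` cl (f @` A).

Definition cnbhs (X : closureSpace) (x : X) (U : set X) : Prop :=
  (~` cl (~` U)) x.

Definition interior_cover (X : closureSpace) (F : set (set X)) : Prop :=
  forall x : X, exists2 U, F U & cnbhs x U.

Record cmap (X Y : closureSpace) := CMap {
  cmap_fun :> X -> Y ;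
  cmap_cts : ccontinuous cmap_fun }.
Arguments cmap_cts {X Y} c.

Section cnbhs.
Context {X : closureSpace}.

Lemma clS (A B : set X) : A `<=` B -> cl A `<=` cl B.
Proof. by move=> /setUidPr <-; rewrite clU; exact: subsetUl. Qed.

Lemma cnbhsS (x : X) (U V : set X) : U `<=` V -> cnbhs x U -> cnbhs x V.
Proof. by move=> UV nU cV; apply: nU; apply: clS cV; exact: subsetC. Qed.

Lemma cnbhsI (x : X) (U V : set X) :
  cnbhs x U -> cnbhs x V -> cnbhs x (U `&` V).
Proof. by move=> nU nV; rewrite /cnbhs setCI clU => -[]. Qed.

Lemma cnbhs_mem (x : X) (U : set X) : cnbhs x U -> U x.
Proof. by move=> nU; apply: contrapT => /(@sub_cl X (~` U)). Qed.

Lemma cnbhsT (x : X) : cnbhs x [set: X].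
Proof. by rewrite /cnbhs setCT cl0. Qed.

End cnbhs.
Arguments cnbhsT {X} x.

Section ccontinuous.
Context {X Y Z : closureSpace}.

Lemma ccontinuousP (f : X -> Y) : ccontinuous f <->
  forall x V, cnbhs (f x) V -> cnbhs x (f @^-1` V).
Proof.
split=> [cf x V nV cx|nf A _ [x cAx <-]].
  by apply: nV; apply: clS (cf _ _ (imageP f cx)) => _ [y ny <-].
apply: contrapT => nfx.
have /nf : cnbhs (f x) (~` (f @` A)) by rewrite /cnbhs setCK.
by apply; apply: clS cAx => y Ay /=; apply; exact: imageP.
Qed.

Lemma ccontinuous_comp (f : X -> Y) (g : Y -> Z) :
  ccontinuous f -> ccontinuous g -> ccontinuous (g \o f).
Proof.
move=> cf cg A _ [x Ax <-]; rewrite -image_comp.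
apply: (cg (f @` A)); exists (f x) => //; exact/cf/imageP.
Qed.

Lemma ccontinuous_id : ccontinuous (@id X).
Proof. by move=> A; rewrite !image_id. Qed.

Lemma ccontinuous_cst (y : Y) : ccontinuous (fun _ : X => y).
Proof.
apply/ccontinuousP => x V /cnbhs_mem Vy.
by apply: (cnbhsS _ (cnbhsT x)) => z _.
Qed.

Lemma cclosed_preimage (f : X -> Y) (C : set Y) :
  ccontinuous f -> cl C `<=` C -> cl (f @^-1` C) `<=` f @^-1` C.
Proof.
by move=> cf cC x /(imageP f)/cf fx; apply: cC; apply: clS fx => _ [y ? <-].
Qed.

End ccontinuous.
Arguments ccontinuous_cst {X Y} y.
Arguments ccontinuous_comp {X Y Z f g} cf cg : rename.

Section top_cs.
Context (T : topologicalType).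

Definition top_cs : closureSpace :=
  @ClosureSpace T (@closure T) (@closure0 T) (@subset_closure T) (@closureU T).

Lemma cnbhs_top (x : top_cs) (U : set T) :
  cnbhs x U <-> nbhs (x : T) U.
Proof.
by rewrite -[cnbhs x U]/((~` closure (~` U)) x) closure_setC setCK.
Qed.

End top_cs.

Section sub_cs.
Context (X : closureSpace) (A : set X).

Let scl (B : set A) : set A := [set z | cl (val @` B) (val z)].

Let scl0 : scl set0 = set0.
Proof. by apply/seteqP; split => z //; rewrite /scl /= image_set0 cl0. Qed.

Let sub_scl B : B `<=` scl B.
Proof. by move=> z Bz; apply: sub_cl; exists z. Qed.

Let sclU B C : scl (B `|` C) = scl B `|` scl C.
Proof. by apply/seteqP; split => z; rewrite /scl /= image_setU clU. Qed.

(* A `&` cl B, read on the subtype A. *)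
Definition sub_cs : closureSpace := ClosureSpace scl0 sub_scl sclU.

Definition sub_pt (x : X) (Ax : A x) : sub_cs := exist _ x (mem_set Ax).

Lemma sub_val_cts : @ccontinuous sub_cs X val.
Proof. by move=> B _ [z cBz <-]. Qed.

Definition sub_val : cmap sub_cs X := CMap sub_val_cts.

Lemma sub_cts (Z : closureSpace) (f : Z -> sub_cs) :
  @ccontinuous Z X (val \o f) -> ccontinuous f.
Proof.
move=> cf B _ [z cBz <-] /=; rewrite /scl /= image_comp.
by apply: cf; exists z.
Qed.

End sub_cs.

Section sub_incl.
Context (X : closureSpace) (A B : set X) (AB : A `<=` B).

Definition sub_incl_fun (z : sub_cs A) : sub_cs B :=
  sub_pt (AB (set_mem (valP z))).

Lemma sub_incl_cts : ccontinuous sub_incl_fun.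
Proof. by apply: sub_cts; exact: sub_val_cts. Qed.

Definition sub_incl : cmap (sub_cs A) (sub_cs B) := CMap sub_incl_cts.

Lemma sub_incl_pt (x : X) (Ax : A x) (Bx : B x) :
  sub_incl (sub_pt Ax) = sub_pt Bx.
Proof. exact: val_inj. Qed.

End sub_incl.

Section prod_cs.
Context (X Y : closureSpace).

Let pcl (A : set (X * Y)) : set (X * Y) := [set p |
  forall V W, cnbhs p.1 V -> cnbhs p.2 W -> (V `*` W) `&` A !=set0].

Let pcl0 : pcl set0 = set0.
Proof.
apply/seteqP; split => // p /(_ _ _ (cnbhsT _) (cnbhsT _)).
by rewrite setI0 => -[].
Qed.

Let sub_pcl A : A `<=` pcl A.
Proof. by move=> p Ap V W /cnbhs_mem ? /cnbhs_mem ?; exists p. Qed.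

Let pclU A B : pcl (A `|` B) = pcl A `|` pcl B.
Proof.
apply/seteqP; split => [p cAB|p [cp|cp] V W nV nW]; last 2 first.
- by have [q [? ?]] := cp _ _ nV nW; exists q; split => //; left.
- by have [q [? ?]] := cp _ _ nV nW; exists q; split => //; right.
apply: contrapT => /not_orP[].
move=> /existsNP[V /existsNP[W /not_implyP[nV /not_implyP[nW VWA]]]].
move=> /existsNP[V' /existsNP[W' /not_implyP[nV' /not_implyP[nW' VWB]]]].
have [q [[[? ?] [? ?]] []] q'] := cAB _ _ (cnbhsI nV nV') (cnbhsI nW nW').
- by apply: VWA; exists q.
- by apply: VWB; exists q.
Qed.

Definition prod_cs : closureSpace := ClosureSpace pcl0 sub_pcl pclU.

Lemma cnbhs_prod (p : prod_cs) (N : set (X * Y)) : cnbhs p N <->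
  exists V W, [/\ cnbhs p.1 V, cnbhs p.2 W & V `*` W `<=` N].
Proof.
split=> [nN|[V [W [nV nW VW]]] /(_ _ _ nV nW)[q []]]; last by move/VW.
apply: contrapT => nVW; apply: nN => V W nV nW; apply: contrapT => VWN.
apply: nVW; exists V, W; split => // q VWq; apply: contrapT => nNq.
by apply: VWN; exists q.
Qed.

Lemma fst_cts : @ccontinuous prod_cs X fst.
Proof.
apply/ccontinuousP => p V nV; apply/cnbhs_prod; exists V, setT.
by split => //; [exact: cnbhsT|move=> q []].
Qed.

Lemma snd_cts : @ccontinuous prod_cs Y snd.
Proof.
apply/ccontinuousP => p V nV; apply/cnbhs_prod; exists setT, V.
by split => //; [exact: cnbhsT|move=> q []].
Qed.

Lemma pair_cts (Z : closureSpace) (f : Z -> X) (g : Z -> Y) :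
  ccontinuous f -> ccontinuous g -> @ccontinuous Z prod_cs (fun z => (f z, g z)).
Proof.
move=> /ccontinuousP cf /ccontinuousP cg; apply/ccontinuousP => z N.
move=> /cnbhs_prod[V [W [/cf nV /cg nW VW]]].
by apply/(cnbhsS _ (cnbhsI nV nW)) => y [? ?]; apply: VW.
Qed.

End prod_cs.

Section top_cts.

Lemma top_cts (S T : topologicalType) (f : S -> T) :
  continuous f -> @ccontinuous (top_cs S) (top_cs T) f.
Proof.
move=> cf; apply/ccontinuousP => x V /cnbhs_top nV.
by apply/cnbhs_top; exact: cf.
Qed.

Lemma top_prod_cts (S T : topologicalType) :
  @ccontinuous (prod_cs (top_cs S) (top_cs T)) (top_cs (S * T)%type) id.
Proof.
apply/ccontinuousP => -[x y] N /cnbhs_top[[V W] /= [nV nW] VW].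
by apply/cnbhs_prod; exists V, W; split => //; exact/cnbhs_top.
Qed.

End top_cts.

Section interval.
Context (R : realType).

Definition itvI : closureSpace := sub_cs (X := top_cs R) `[0, 1].

Lemma clamp_in (t : R) : `[0, 1]%classic (Num.max 0 (Num.min 1 t)).
Proof.
by rewrite /= in_itv /= le_max lexx /= ge_max ler01 /= ge_min lexx.
Qed.

(* Nearest-point retraction of R onto [0, 1]; the identity on [0, 1]. *)
Definition toI (t : R) : itvI := sub_pt (X := top_cs R) (clamp_in t).

Definition valI (t : itvI) : R := val t.

Definition I0 : itvI := toI 0.
Definition I1 : itvI := toI 1.

Lemma valI_itv t : 0 <= valI t <= 1.
Proof. by have := set_mem (valP t); rewrite /= in_itv. Qed.

Lemma valI_ge0 t : 0 <= valI t.
Proof. by have /andP[] := valI_itv t. Qed.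

Lemma valI_le1 t : valI t <= 1.
Proof. by have /andP[] := valI_itv t. Qed.

Lemma valIK : cancel valI toI.
Proof.
move=> t; apply: val_inj => /=; have := valI_ge0 t; have := valI_le1 t.
by rewrite /valI => t1 t0; rewrite min_r// max_r.
Qed.

Lemma toIK t : 0 <= t <= 1 -> valI (toI t) = t.
Proof. by move=> /andP[t0 t1]; rewrite /valI /= min_r// max_r. Qed.

Lemma toI_le0 t : t <= 0 -> toI t = I0.
Proof.
move=> t0; apply: val_inj => /=; rewrite (@min_r _ _ 1 t) ?max_l//.
  by rewrite min_r// maxxx.
by rewrite (le_trans t0).
Qed.

Lemma toI_ge1 t : 1 <= t -> toI t = I1.
Proof. by move=> t1; apply: val_inj => /=; rewrite min_l// minxx. Qed.

Lemma valI0 : valI I0 = 0. Proof. by rewrite toIK// lexx ler01. Qed.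
Lemma valI1 : valI I1 = 1. Proof. by rewrite toIK// lexx ler01. Qed.

Lemma valI_cts : @ccontinuous itvI (top_cs R) valI.
Proof. exact: sub_val_cts. Qed.

Lemma toI_cts : @ccontinuous (top_cs R) itvI toI.
Proof.
apply: sub_cts; apply: (@top_cts R R) => t.
by apply: continuous_max; [exact: cst_continuous|];
  apply: continuous_min; [exact: cst_continuous|exact: cvg_id].
Qed.

Lemma real1_cts (f : R -> R) : continuous f ->
  @ccontinuous itvI (top_cs R) (f \o valI).
Proof. by move=> cf; apply: ccontinuous_comp valI_cts (top_cts cf). Qed.

Lemma realI1_cts (f : R -> R) : continuous f ->
  @ccontinuous itvI itvI (fun t => toI (f (valI t))).
Proof. by move=> /real1_cts cf; apply: ccontinuous_comp cf toI_cts. Qed.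

Lemma realI2_cts (Z : closureSpace) (f : R * R -> R) (g h : Z -> itvI) :
  continuous f -> ccontinuous g -> ccontinuous h ->
  @ccontinuous Z itvI (fun z => toI (f (valI (g z), valI (h z)))).
Proof.
move=> cf cg ch; apply: (ccontinuous_comp _ toI_cts).
apply: (ccontinuous_comp (Y := top_cs (R * R)%type) _ (top_cts cf)).
apply: (ccontinuous_comp _ (@top_prod_cts R R)).
by apply: pair_cts; [exact: ccontinuous_comp cg valI_cts|
  exact: ccontinuous_comp ch valI_cts].
Qed.

Lemma paste_cts (Z X : closureSpace) (k : Z -> itvI) (f g : Z -> X) :
  ccontinuous k -> ccontinuous f -> ccontinuous g ->
  (forall z, valI (k z) = 2^-1 -> f z = g z) ->
  ccontinuous (fun z => if valI (k z) <= 2^-1 then f z else g z).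
Proof.
move=> ck cf cg fg; have ckR := ccontinuous_comp ck valI_cts.
have cA : cl [set z | valI (k z) <= 2^-1] `<=` [set z | valI (k z) <= 2^-1].
  exact: (cclosed_preimage ckR (@closed_le R 2^-1)).
have cB : cl [set z | 2^-1 <= valI (k z)] `<=` [set z | 2^-1 <= valI (k z)].
  exact: (cclosed_preimage ckR (@closed_ge R 2^-1)).
move=> S _ [z cSz <-].
rewrite -(setUIDK S [set z | valI (k z) <= 2^-1]) clU in cSz.
case: cSz => cz.
- have kz : cl [set z | valI (k z) <= 2^-1] z by apply: clS cz => y [].
  rewrite (cA _ kz).
  apply: clS (cf _ _ (imageP f cz)) => _ [y [Sy /= ky] <-].
  by exists y => //; rewrite ky.
- have /cB /= kz : cl [set z | 2^-1 <= valI (k z)] z.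
    by apply: clS cz => y [_ /= /negP]; rewrite -ltNge => /ltW.
  have -> : (if valI (k z) <= 2^-1 then f z else g z) = g z.
    case: ifPn => // kz'; apply: fg; apply/eqP.
    by rewrite eq_le kz kz'.
  apply: clS (cg _ _ (imageP g cz)) => _ [y [Sy /= /negP/negbTE ky] <-].
  by exists y => //; rewrite ky.
Qed.

End interval.

Section paths.
Context {R : realType}.
Local Notation I := (itvI R).

Definition path_connected (X : closureSpace) : Prop :=
  forall x y : X, exists f : I -> X,
    [/\ ccontinuous f, f (I0 R) = x & f (I1 R) = y].

Section path_ops.
Context {X : closureSpace}.

Definition concat_fun (v w : I -> X) (t : I) : X :=
  if valI t <= 2^-1 then v (toI (2 * valI t)) else w (toI (2 * valI t - 1)).

Definition rev_fun (v : I -> X) (t : I) : X := v (toI (1 - valI t)).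

(* In a pair (t, s), t is the path parameter and s the homotopy parameter. *)
Definition homotopic_rel (f g : I -> X) : Prop :=
  exists H : prod_cs I I -> X,
    [/\ ccontinuous H,
        forall t, H (t, I0 R) = f t,
        forall t, H (t, I1 R) = g t &
        forall s, H (I0 R, s) = f (I0 R) /\ H (I1 R, s) = f (I1 R)].

End path_ops.

Lemma double_cts : ccontinuous (fun t : I => toI (2 * valI t)).
Proof.
by apply: (@realI1_cts R (fun t => 2 * t)) => t; apply: mulrl_continuous.
Qed.

Lemma double1_cts : ccontinuous (fun t : I => toI (2 * valI t - 1)).
Proof.
apply: (@realI1_cts R (fun t => 2 * t - 1)) => t.
by apply: continuousB; [exact: mulrl_continuous|exact: cst_continuous].
Qed.

Lemma flip_cts : ccontinuous (fun t : I => toI (1 - valI t)).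
Proof.
apply: (@realI1_cts R (fun t => 1 - t)) => t.
by apply: continuousB; [exact: cst_continuous|exact: cvg_id].
Qed.

Section path_lemmas.
Context {X : closureSpace}.
Implicit Types (f g h v w : I -> X).

Lemma half_eq (t : R) : t = 2^-1 -> 2 * t = 1 /\ 2 * t - 1 = 0.
Proof. by move=> ->; split; lra. Qed.

Lemma concat_cts v w : ccontinuous v -> ccontinuous w ->
  v (I1 R) = w (I0 R) -> ccontinuous (concat_fun v w).
Proof.
move=> cv cw vw; apply: (paste_cts (k := id)); first exact: ccontinuous_id.
- exact: ccontinuous_comp double_cts cv.
- exact: ccontinuous_comp double1_cts cw.
- by move=> t /half_eq[-> ->].
Qed.

Lemma concat0 v w : concat_fun v w (I0 R) = v (I0 R).
Proof. by rewrite /concat_fun valI0 mulr0 invr_ge0 ler0n. Qed.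

Lemma concat1 v w : concat_fun v w (I1 R) = w (I1 R).
Proof.
rewrite /concat_fun valI1 mulr1 ifN; last by rewrite -ltNge; lra.
by congr (w (toI _)); ring.
Qed.

Lemma rev_cts v : ccontinuous v -> ccontinuous (rev_fun v).
Proof. by move=> cv; exact: ccontinuous_comp flip_cts cv. Qed.

Lemma rev0 v : rev_fun v (I0 R) = v (I1 R).
Proof. by rewrite /rev_fun valI0 subr0. Qed.

Lemma rev1 v : rev_fun v (I1 R) = v (I0 R).
Proof. by rewrite /rev_fun valI1 subrr. Qed.

Lemma revK v : rev_fun (rev_fun v) = v.
Proof.
apply/funext => t; rewrite /rev_fun toIK; last first.
  by have := valI_itv t => /andP[? ?]; apply/andP; split; lra.
by rewrite -[in RHS](valIK t); congr (v (toI _)); ring.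
Qed.

Lemma homotopic_refl f : ccontinuous f -> homotopic_rel f f.
Proof.
by move=> cf; exists (f \o fst); split => //;
  exact: ccontinuous_comp (@fst_cts _ _) cf.
Qed.

Lemma homotopic_sym f g : homotopic_rel f g -> homotopic_rel g f.
Proof.
move=> [H [cH H0 H1 Hb]].
have Hg : g (I0 R) = f (I0 R) /\ g (I1 R) = f (I1 R).
  by rewrite -!H1; exact: Hb.
exists (fun p => H (p.1, toI (1 - valI p.2))); split.
- apply: (ccontinuous_comp _ cH); apply: pair_cts; first exact: fst_cts.
  exact: ccontinuous_comp (@snd_cts _ _) flip_cts.
- by move=> t /=; rewrite valI0 subr0 H1.
- by move=> t /=; rewrite valI1 subrr H0.
- by move=> s /=; rewrite Hg.1 Hg.2; exact: Hb.
Qed.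

Lemma homotopic_trans f g h :
  homotopic_rel f g -> homotopic_rel g h -> homotopic_rel f h.
Proof.
move=> [H [cH H0 H1 Hb]] [K [cK K0 K1 Kb]].
have Hg : g (I0 R) = f (I0 R) /\ g (I1 R) = f (I1 R).
  by rewrite -!H1; exact: Hb.
exists (fun p => if valI p.2 <= 2^-1 then H (p.1, toI (2 * valI p.2))
                 else K (p.1, toI (2 * valI p.2 - 1))); split.
- apply: (@paste_cts R (prod_cs I I) X snd (fun p => H (p.1, toI (2 * valI p.2)))
            (fun p => K (p.1, toI (2 * valI p.2 - 1)))); first exact: snd_cts.
  + apply: (ccontinuous_comp _ cH); apply: pair_cts; first exact: fst_cts.
    exact: ccontinuous_comp (@snd_cts _ _) double_cts.
  + apply: (ccontinuous_comp _ cK); apply: pair_cts; first exact: fst_cts.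
    exact: ccontinuous_comp (@snd_cts _ _) double1_cts.
  + by move=> [t s] /= /half_eq[-> ->]; rewrite H1 K0.
- move=> t.
  exact: etrans (concat0 (fun s => H (t, s)) (fun s => K (t, s))) (H0 t).
- move=> t.
  exact: etrans (concat1 (fun s => H (t, s)) (fun s => K (t, s))) (K1 t).
- move=> s /=; case: ifP => _; first exact: Hb.
  by rewrite -Hg.1 -Hg.2; exact: Kb.
Qed.

Lemma homotopic_concat f f' g g' : f (I1 R) = g (I0 R) ->
  homotopic_rel f f' -> homotopic_rel g g' ->
  homotopic_rel (concat_fun f g) (concat_fun f' g').
Proof.
move=> fg [H [cH H0 H1 Hb]] [K [cK K0 K1 Kb]].
exists (fun p => if valI p.1 <= 2^-1 then H (toI (2 * valI p.1), p.2)
                 else K (toI (2 * valI p.1 - 1), p.2)); split.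
- apply: (@paste_cts R (prod_cs I I) X fst (fun p => H (toI (2 * valI p.1), p.2))
            (fun p => K (toI (2 * valI p.1 - 1), p.2))); first exact: fst_cts.
  + apply: (ccontinuous_comp _ cH); apply: pair_cts; last exact: snd_cts.
    exact: ccontinuous_comp (@fst_cts _ _) double_cts.
  + apply: (ccontinuous_comp _ cK); apply: pair_cts; last exact: snd_cts.
    exact: ccontinuous_comp (@fst_cts _ _) double1_cts.
  + move=> [t s] /= /half_eq[-> ->].
    by rewrite -/(I1 R) -/(I0 R) (Hb s).2 (Kb s).1.
- by move=> t; rewrite /concat_fun /=; case: ifP.
- by move=> t; rewrite /concat_fun /=; case: ifP.
- move=> s; rewrite concat0 concat1; split.
  + exact: etrans (concat0 (fun t => H (t, s)) (fun t => K (t, s))) (Hb s).1.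
  + exact: etrans (concat1 (fun t => H (t, s)) (fun t => K (t, s))) (Kb s).2.
Qed.

Lemma homotopic_rev f f' :
  homotopic_rel f f' -> homotopic_rel (rev_fun f) (rev_fun f').
Proof.
move=> [H [cH H0 H1 Hb]].
exists (fun p => H (toI (1 - valI p.1), p.2)); split.
- apply: (ccontinuous_comp _ cH); apply: pair_cts; last exact: snd_cts.
  exact: ccontinuous_comp (@fst_cts _ _) flip_cts.
- by move=> t; rewrite H0.
- by move=> t; rewrite H1.
- move=> s; rewrite rev0 rev1 /= valI0 valI1 subr0 subrr.
  by split; [exact: (Hb s).2|exact: (Hb s).1].
Qed.

Lemma homotopic_comp (Y : closureSpace) (k : X -> Y) f f' :
  ccontinuous k -> homotopic_rel f f' -> homotopic_rel (k \o f) (k \o f').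
Proof.
move=> ck [H [cH H0 H1 Hb]]; exists (k \o H); split.
- exact: ccontinuous_comp cH ck.
- by move=> t /=; rewrite H0.
- by move=> t /=; rewrite H1.
- by move=> s /=; rewrite (Hb s).1 (Hb s).2.
Qed.

Lemma comp_concat (Y : closureSpace) (k : X -> Y) v w :
  k \o concat_fun v w = concat_fun (k \o v) (k \o w).
Proof. by apply/funext => t; rewrite /concat_fun /=; case: ifP. Qed.

Lemma homotopic_reparam f (p q : I -> I) : ccontinuous f ->
  ccontinuous p -> ccontinuous q ->
  p (I0 R) = q (I0 R) -> p (I1 R) = q (I1 R) ->
  homotopic_rel (f \o p) (f \o q).
Proof.
move=> cf cp cq pq0 pq1.
pose L (z : prod_cs I I) : I :=
  toI ((1 - valI z.2) * valI (p z.1) + valI z.2 * valI (q z.1)).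
have cL : ccontinuous L.
  pose k (z : prod_cs I I) := toI ((1 - valI z.2) * valI (p z.1)).
  pose l (z : prod_cs I I) := toI (valI z.2 * valI (q z.1)).
  have ck : ccontinuous k.
    apply: (@realI2_cts R (prod_cs I I) (fun a => (1 - a.1) * a.2) snd (p \o fst)).
    - move=> a; apply: (@cvgM R _ (nbhs a) _ (fun a => 1 - a.1) snd).
        by apply: cvgB; [exact: cvg_cst|exact: cvg_fst].
      exact: cvg_snd.
    - exact: snd_cts.
    - exact: ccontinuous_comp (@fst_cts _ _) cp.
  have ccl : ccontinuous l.
    apply: (@realI2_cts R (prod_cs I I) (fun a => a.1 * a.2) snd (q \o fst)).
    - by move=> a; apply: cvgM; [exact: cvg_fst|exact: cvg_snd].
    - exact: snd_cts.
    - exact: ccontinuous_comp (@fst_cts _ _) cq.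
  have -> : L = fun z => toI (valI (k z) + valI (l z)).
    apply/funext => z; rewrite /L /k /l.
    have /andP[s0 s1] := valI_itv z.2.
    have /andP[p0 p1] := valI_itv (p z.1).
    have /andP[q0 q1] := valI_itv (q z.1).
    by rewrite !toIK//; apply/andP; split; nra.
  apply: (@realI2_cts R (prod_cs I I) (fun a => a.1 + a.2) k l) => //.
  by move=> a; apply: cvgD; [exact: cvg_fst|exact: cvg_snd].
have Lpp z : p z.1 = q z.1 -> L z = p z.1.
  by move=> pq; rewrite -[RHS]valIK /L -pq; congr toI; ring.
exists (f \o L); split.
- exact: ccontinuous_comp cL cf.
- by move=> t; rewrite /L /= valI0 subr0 mul1r mul0r addr0 valIK.
- by move=> t; rewrite /L /= valI1 subrr mul1r mul0r add0r valIK.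
- by move=> s /=; rewrite !Lpp.
Qed.

Lemma homotopic_concat1l f : ccontinuous f ->
  homotopic_rel (concat_fun (fun=> f (I0 R)) f) f.
Proof.
move=> cf; have -> : concat_fun (fun=> f (I0 R)) f =
    f \o (fun t => toI (2 * valI t - 1)).
  apply/funext => t; rewrite /concat_fun /=; case: ifP => // t2.
  by rewrite toI_le0//; lra.
apply: (@homotopic_reparam f _ id) => //.
- exact: double1_cts.
- exact: ccontinuous_id.
- by rewrite toI_le0// valI0; lra.
- by rewrite toI_ge1// valI1; lra.
Qed.

Lemma homotopic_concat1r f : ccontinuous f ->
  homotopic_rel (concat_fun f (fun=> f (I1 R))) f.
Proof.
move=> cf; have -> : concat_fun f (fun=> f (I1 R)) =
    f \o (fun t => toI (2 * valI t)).
  apply/funext => t; rewrite /concat_fun /=; case: ifPn => //.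
  by rewrite -ltNge => t2; rewrite toI_ge1//; lra.
apply: (@homotopic_reparam f _ id) => //.
- exact: double_cts.
- exact: ccontinuous_id.
- by rewrite toI_le0// valI0; lra.
- by rewrite toI_ge1// valI1; lra.
Qed.

Lemma homotopic_concatV f : ccontinuous f ->
  homotopic_rel (concat_fun f (rev_fun f)) (fun=> f (I0 R)).
Proof.
move=> cf; pose p (t : I) : I := toI (Num.min (2 * valI t) (2 - 2 * valI t)).
have -> : concat_fun f (rev_fun f) = f \o p.
  apply/funext => t; rewrite /concat_fun /rev_fun /p /=.
  have /andP[t0 t1] := valI_itv t.
  case: ifPn; rewrite -?ltNge => t2; first by rewrite min_l//; lra.
  rewrite min_r; last lra.
  rewrite toIK; last by apply/andP; split; lra.
  by congr (f (toI _)); ring.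
apply: (@homotopic_reparam f p (fun=> I0 R)) => //.
- apply: (@realI1_cts R (fun t => Num.min (2 * t) (2 - 2 * t))) => t.
  apply: continuous_min; first exact: mulrl_continuous.
  by apply: continuousB; [exact: cst_continuous|exact: mulrl_continuous].
- exact: ccontinuous_cst.
- by rewrite /p toI_le0// valI0 mulr0 ge_min lexx.
- by rewrite /p toI_le0// valI1 mulr1 subrr ge_min lexx orbT.
Qed.

Lemma homotopic_concatA u v w : ccontinuous u -> ccontinuous v ->
  ccontinuous w -> u (I1 R) = v (I0 R) -> v (I1 R) = w (I0 R) ->
  homotopic_rel (concat_fun u (concat_fun v w)) (concat_fun (concat_fun u v) w).
Proof.
move=> cu cv cw uv vw; apply: homotopic_sym.
pose m (t : R) := Num.min (2 * t) (Num.min (t + 4^-1) (2^-1 * t + 2^-1)).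
pose p (t : I) : I := toI (m (valI t)).
have -> : concat_fun (concat_fun u v) w = concat_fun u (concat_fun v w) \o p.
  apply/funext => t; have /andP[t0 t1] := valI_itv t; rewrite /p /=.
  have [t4|t4] := leP (valI t) 4^-1.
    have -> : m (valI t) = 2 * valI t.
      by rewrite /m !min_l ?le_min//; try (apply/andP; split); lra.
    rewrite {1}/concat_fun ifT; last lra.
    by rewrite /concat_fun toIK ?ifT//; try (apply/andP; split); lra.
  have [t2|t2] := leP (valI t) 2^-1.
    have -> : m (valI t) = valI t + 4^-1.
      by rewrite /m [X in Num.min _ X]min_l ?min_r//; lra.
    rewrite {1}/concat_fun t2 /concat_fun toIK; last by apply/andP; split; lra.
    rewrite ifN -?ltNge; last lra.
    rewrite toIK; last by apply/andP; split; lra.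
    rewrite ifN -?ltNge; last lra.
    rewrite toIK; last by apply/andP; split; lra.
    rewrite ifT; last lra.
    by congr (v (toI _)); lra.
  have -> : m (valI t) = 2^-1 * valI t + 2^-1.
    by rewrite /m [X in Num.min _ X]min_r ?min_r//; lra.
  rewrite /concat_fun [in LHS]ifN -?ltNge//.
  rewrite toIK; last by apply/andP; split; lra.
  rewrite ifN -?ltNge; last lra.
  rewrite toIK; last by apply/andP; split; lra.
  rewrite ifN -?ltNge; last lra.
  by congr (w (toI _)); lra.
apply: (@homotopic_reparam (concat_fun u (concat_fun v w)) p id).
- by apply: concat_cts; [|exact: concat_cts|rewrite concat0].
- apply: realI1_cts => t; apply: continuous_min; first exact: mulrl_continuous.
  apply: continuous_min.
    by apply: continuousD; [exact: cvg_id|exact: cst_continuous].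
  by apply: continuousD; [exact: mulrl_continuous|exact: cst_continuous].
- exact: ccontinuous_id.
- by rewrite /p toI_le0// /m valI0 mulr0 ge_min lexx.
- by rewrite /p toI_ge1// /m valI1 !le_min; apply/and3P; split; lra.
Qed.

End path_lemmas.
End paths.

Arguments path_connected : clear implicits.

Section loops.
Context {R : realType} {X : closureSpace} {x : X}.
Local Notation I := (itvI R).

Record loop := Loop {
  loop_fun :> I -> X ;
  loop_cts : ccontinuous loop_fun ;
  loop0 : loop_fun (I0 R) = x ;
  loop1 : loop_fun (I1 R) = x }.
Arguments loop_cts : clear implicits.

HB.instance Definition _ := gen_eqMixin loop.
HB.instance Definition _ := gen_choiceMixin loop.

Lemma loop10 (v w : loop) : v (I1 R) = w (I0 R).
Proof. by rewrite loop1 loop0. Qed.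

Definition concat (v w : loop) : loop :=
  Loop (concat_cts (loop_cts v) (loop_cts w) (loop10 v w))
    (etrans (concat0 v w) (loop0 v)) (etrans (concat1 v w) (loop1 w)).

Definition rev_loop (v : loop) : loop :=
  Loop (rev_cts (loop_cts v)) (etrans (rev0 v) (loop1 v))
    (etrans (rev1 v) (loop0 v)).

Definition cst_loop : loop := @Loop (fun=> x) (ccontinuous_cst x) erefl erefl.

Definition homotopic (v w : loop) : bool := `[< homotopic_rel v w >].

Lemma homotopicR : reflexive homotopic.
Proof. by move=> v; apply/asboolP; apply: homotopic_refl; exact: loop_cts. Qed.

Lemma homotopicS : symmetric homotopic.
Proof. by move=> v w; apply/asboolP/asboolP; exact: homotopic_sym. Qed.

Lemma homotopicT : transitive homotopic.
Proof.
by move=> w v u /asboolP vw /asboolP wu; apply/asboolP;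
  exact: homotopic_trans vw wu.
Qed.

Canonical homotopic_equiv := EquivRel homotopic homotopicR homotopicS homotopicT.

End loops.

Arguments loop : clear implicits.
Arguments loop_cts {R X x} l.

Definition pi1 (R : realType) (X : closureSpace) (x : X) : Type :=
  {eq_quot (@homotopic R X x)}.

Section pi1.
Context {R : realType} {X : closureSpace} {x : X}.
Local Notation P := (pi1 R x).

HB.instance Definition _ := Choice.on P.
HB.instance Definition _ := EqQuotient.on P.

Definition pi1_class (v : loop R X x) : P := \pi_P v.

Lemma pi1_classP (v w : loop R X x) :
  homotopic_rel v w <-> pi1_class v = pi1_class w.
Proof.
by split=> [vw|/eqmodP/asboolP//]; apply/eqmodP/asboolP.
Qed.

Lemma pi1_ind (Q : P -> Prop) : (forall v, Q (pi1_class v)) -> forall a, Q a.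
Proof. by move=> Qv a; rewrite -[a]reprK; exact: Qv. Qed.

Lemma repr_class (v : loop R X x) : homotopic_rel (repr (pi1_class v)) v.
Proof. by apply/pi1_classP; rewrite /pi1_class reprK. Qed.

Definition pi1_mul (a b : P) : P := pi1_class (concat (repr a) (repr b)).
Definition pi1_one : P := pi1_class cst_loop.
Definition pi1_inv (a : P) : P := pi1_class (rev_loop (repr a)).

Lemma pi1_mulE (v w : loop R X x) :
  pi1_mul (pi1_class v) (pi1_class w) = pi1_class (concat v w).
Proof.
by apply/pi1_classP; apply: homotopic_concat; rewrite ?loop1 ?loop0//;
  exact: repr_class.
Qed.

Lemma pi1_invE (v : loop R X x) :
  pi1_inv (pi1_class v) = pi1_class (rev_loop v).
Proof. by apply/pi1_classP; apply: homotopic_rev; exact: repr_class. Qed.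

Lemma pi1_mulA : associative pi1_mul.
Proof.
elim/pi1_ind => u; elim/pi1_ind => v; elim/pi1_ind => w.
rewrite !pi1_mulE; apply/pi1_classP.
by apply: homotopic_concatA; rewrite ?loop1 ?loop0//; exact: loop_cts.
Qed.

Lemma pi1_mul1g : left_id pi1_one pi1_mul.
Proof.
elim/pi1_ind => v; rewrite pi1_mulE; apply/pi1_classP.
by have := homotopic_concat1l (loop_cts v); rewrite loop0.
Qed.

Lemma pi1_mulg1 : right_id pi1_one pi1_mul.
Proof.
elim/pi1_ind => v; rewrite pi1_mulE; apply/pi1_classP.
by have := homotopic_concat1r (loop_cts v); rewrite loop1.
Qed.

Lemma pi1_mulgV : right_inverse pi1_one pi1_inv pi1_mul.
Proof.
elim/pi1_ind => v; rewrite pi1_invE pi1_mulE; apply/pi1_classP.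
by have := homotopic_concatV (loop_cts v); rewrite loop0.
Qed.

Lemma pi1_mulVg : left_inverse pi1_one pi1_inv pi1_mul.
Proof.
elim/pi1_ind => v; rewrite pi1_invE pi1_mulE; apply/pi1_classP.
have := homotopic_concatV (loop_cts (rev_loop v)).
by rewrite loop0 /= revK.
Qed.

HB.instance Definition _ :=
  isGroup.Build P pi1_mulA pi1_mul1g pi1_mulg1 pi1_mulVg pi1_mulgV.

End pi1.

Section pi1_map.
Context {R : realType} {X Y : closureSpace} (f : cmap X Y).
Context {x : X} {y : Y} (fx : f x = y).

Definition map_loop (v : loop R X x) : loop R Y y :=
  Loop (ccontinuous_comp (loop_cts v) (cmap_cts f))
    (etrans (congr1 f (loop0 v)) fx) (etrans (congr1 f (loop1 v)) fx).

Definition pi1_map (a : pi1 R x) : pi1 R y := pi1_class (map_loop (repr a)).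

Lemma pi1_mapE (v : loop R X x) :
  pi1_map (pi1_class v) = pi1_class (map_loop v).
Proof.
by apply/pi1_classP; apply: homotopic_comp (cmap_cts f) (repr_class v).
Qed.

Lemma pi1_mapM : {morph pi1_map : a b / (a * b)%g}.
Proof.
elim/(@pi1_ind R X x) => v; elim/(@pi1_ind R X x) => w.
rewrite [(_ * _)%g]pi1_mulE !pi1_mapE [(_ * _)%g]pi1_mulE.
apply/pi1_classP; rewrite /= comp_concat; apply: homotopic_refl.
exact: (loop_cts (concat (map_loop v) (map_loop w))).
Qed.

HB.instance Definition _ := isMultiplicative.Build _ _ pi1_map pi1_mapM.

End pi1_map.

Arguments pi1_map R {X Y} f {x y} fx.

(* Between groups, multiplicative maps are the group homomorphisms. *)
Definition is_pushout (G12 G1 G2 G : groupType)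
    (i1 : {multiplicative G12 -> G1}) (i2 : {multiplicative G12 -> G2})
    (j1 : {multiplicative G1 -> G}) (j2 : {multiplicative G2 -> G}) : Prop :=
  j1 \o i1 =1 j2 \o i2 /\
  forall (K : groupType)
      (k1 : {multiplicative G1 -> K}) (k2 : {multiplicative G2 -> K}),
    k1 \o i1 =1 k2 \o i2 ->
    exists h : {multiplicative G -> K},
      [/\ h \o j1 =1 k1, h \o j2 =1 k2 &
          forall h' : {multiplicative G -> K},
            h' \o j1 =1 k1 -> h' \o j2 =1 k2 -> h' =1 h].

(* Main.v *)
From HB Require Import structures.
Require Import Defs.
From mathcomp Require Import all_boot all_order all_algebra.
From mathcomp Require Import all_classical all_reals topology normedtype.
From mathcomp Require Import ring lra.

(** Let K be a group.  The proof replaces homomorphisms from fundamental groups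
    to K by path functors: functions from paths to K that are invariant under
    homotopy relative to the end points and multiplicative for concatenation.

    The heart of the matter is a statement without base points: if w is defined
    on the paths that lie in a member of an interior cover, and is a path functor
    on each member, then w extends to a path functor on X
    ([path_functor_extension]), and a path functor on X is determined by its
    values on these small paths ([path_functor_unique]).  The extension is an
    integral.  Along a path f, a primitive of w is a K-valued function g on
    [0, 1] with g b = g a * w (f restricted to [a, b]) whenever this restriction
    is small.  Since w is multiplicative on small paths, a primitive exists and is
    unique once g 0 = 1, and the value of the extension at f is g 1.  In a homotopy,
    the primitives of two nearby rows differ by the weights of the small
    vertical paths between them, which are trivial at both ends; so g 1 does not
    change ([primitive_homotopy]).  That the closure of X is not idempotent does no
    harm: all arguments take place in R or R * R, and only use that each point has
    a ball which is mapped into a member of the cover.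

    To pass between homomorphisms and path functors, choose for each z a path c z
    from the base point to z which stays in U1 if z is in U1 and in U2 if z is in
    U2; for this the intersection has to be path-connected.  A homomorphism k on a
    fundamental group gives the path functor f |-> k [c (f 0) f (c (f 1))^-1],
    which has the value k [v] at a loop v ([induced_loop]).  Homomorphisms k1, k2
    that agree on the fundamental group of the intersection give path functors on
    U1 and U2 that agree on the common paths; they extend to X, and the value of
    the extension on loops is the homomorphism sought.  Any other
    solution gives another path functor on X with the same values on small
    paths, hence is equal to it. *)

Set Implicit Arguments.
Unset Strict Implicit.
Unset Printing Implicit Defensive.

Import Order.TTheory GRing.Theory Num.Theory.
Import numFieldNormedType.Exports.

Local Open Scope classical_set_scope.

(** * Real induction and segments *)

Section geometry.
Local Open Scope ring_scope.
Variable R : realType.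
Local Notation I := (itvI R).

(** Compactness and connectedness of [0, 1] in one principle: the supremum of
    the t in [0, 1] with P t has such points t arbitrarily close below it, and the
    step there carries P past it, unless it is 1.  Every passage from local to
    global below goes through it, so no subdivision of a path or of a square is
    ever chosen. *)
Lemma real_induction (P : R -> Prop) : P 0 ->
  (forall x : R, 0 <= x <= 1 -> exists2 e : R, 0 < e &
     forall a b : R, 0 <= a -> a <= b -> b <= 1 -> ball x e a -> ball x e b ->
       P a -> P b) ->
  P 1.
Proof.
move=> P0 step.
pose S := [set t | 0 <= t <= 1 /\ P t].
have S0 : S 0 by split => //; rewrite lexx ler01.
have Sub : ubound S 1 by move=> t [/andP[]].
have supS : has_sup S by split; [exists 0|exists 1].
have s0 : 0 <= sup S by apply: ub_le_sup => //; exists 1.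
have s1 : sup S <= 1 by apply: ge_sup => //; exists 0.
have [|e e0 He] := step (sup S); first by rewrite s0.
have [a [/andP[a0 a1] Pa] ea] := sup_adherent e0 supS.
have as_ : a <= sup S by apply: ub_le_sup; [exists 1|split => //; rewrite a0].
have ballP t : sup S - e < t -> t < sup S + e -> ball (sup S) e t.
  by move=> ? ?; rewrite /ball /= ltr_distlC; apply/andP; split.
have Pm b : a <= b -> b <= 1 -> b < sup S + e -> P b.
  move=> ab b1 be; apply: (He a b) => //; apply: ballP => //; last first.
    exact: lt_le_trans ea ab.
  by rewrite (le_lt_trans as_)// ltrDl.
have [s1e|s1e] := ltP 1 (sup S + e); first exact: Pm.
have : S (sup S + e / 2).
  split; first by apply/andP; split; lra.
  by apply: Pm; lra.
move=> /(ub_le_sup (ex_intro _ 1 Sub)); lra.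
Qed.

Section normed.
Variable E : normedModType R.

Definition seg_pt (p q : E) (t : R) : E := p + t *: (q - p).

Definition seg (p q : E) (t : I) : top_cs E := seg_pt p q (valI t).

Definition convex (C : set E) : Prop := forall p q t,
  C p -> C q -> 0 <= t <= 1 -> C (seg_pt p q t).

Lemma convex_ball (x : E) (r : R) : convex (ball x r).
Proof.
move=> p q t; rewrite -ball_normE /= => xp xq /andP[t0 t1].
have -> : x - seg_pt p q t = (1 - t) *: (x - p) + t *: (x - q).
  rewrite scalerBl scale1r -addrA [- _ + _]addrC -scalerBr.
  have -> : x - q - (x - p) = - (q - p) by rewrite !opprB addrC subrKA.
  by rewrite scalerN opprD addrA.
rewrite (le_lt_trans (ler_normD _ _))// !normrZ !ger0_norm ?subr_ge0//.
have [->|t0'] := eqVneq t 0; first by rewrite subr0 mul1r mul0r addr0.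
have {t0' t0}t0 : 0 < t by rewrite lt_def t0' t0.
have -> : r = (1 - t) * r + t * r by ring.
apply: ler_ltD; first by rewrite ler_wpM2l ?subr_ge0// ltW.
by rewrite ltr_pM2l.
Qed.

Lemma seg0 p q : seg p q (I0 R) = p.
Proof. by rewrite /seg /seg_pt valI0 scale0r addr0. Qed.

Lemma seg1 p q : seg p q (I1 R) = q.
Proof. by rewrite /seg /seg_pt valI1 scale1r addrC subrK. Qed.

Lemma seg_in (C : set E) p q t : convex C -> C p -> C q -> C (seg p q t).
Proof. by move=> cC Cp Cq; apply: cC => //; exact: valI_itv. Qed.

(** In this generality (the end points move too) the lemma gives both the
    continuity of segments and that of straight-line homotopies. *)
Lemma straight_cts (Z : closureSpace) (a b : Z -> top_cs E) (s : Z -> I) :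
  ccontinuous a -> ccontinuous b -> ccontinuous s ->
  @ccontinuous Z (top_cs E) (fun z => seg (a z) (b z) (s z)).
Proof.
move=> ca cb cs.
pose k (z : R * (E * E)) : E := seg_pt z.2.1 z.2.2 z.1.
have ck : continuous k.
  move=> z; rewrite /k /seg_pt.
  have c1 : (fun z : R * (E * E) => z.2.1) @ z --> z.2.1.
    by apply: continuous_comp; [exact: cvg_snd|exact: cvg_fst].
  have c2 : (fun z : R * (E * E) => z.2.2) @ z --> z.2.2.
    by apply: continuous_comp; [exact: cvg_snd|exact: cvg_snd].
  apply: cvgD => //; apply: cvgZ; first exact: cvg_fst.
  exact: cvgB.
pose ab (z : Z) : top_cs (E * E)%type := (a z, b z).
have cab : ccontinuous ab.
  exact: (ccontinuous_comp (pair_cts ca cb) (@top_prod_cts E E)).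
have csv : @ccontinuous Z (top_cs R) (fun z => valI (s z)).
  exact: (ccontinuous_comp cs (@valI_cts R)).
have cz : @ccontinuous Z (top_cs (R * (E * E))%type) (fun z => (valI (s z), ab z)).
  exact: (ccontinuous_comp (pair_cts csv cab) (@top_prod_cts R (E * E)%type)).
exact: (ccontinuous_comp cz (top_cts ck)).
Qed.

Lemma seg_cts p q : ccontinuous (seg p q).
Proof.
apply: (@straight_cts I (fun=> p) (fun=> q) id); try exact: ccontinuous_cst.
exact: ccontinuous_id.
Qed.

End normed.
End geometry.

(** * Path functors and their primitives *)

Section path_functors.
Local Open Scope ring_scope.
Context {R : realType} {K : groupType}.
Local Notation I := (itvI R).

Section on_subset.
Context {X : closureSpace}.
Implicit Types (U : set X) (w : (I -> X) -> K).

(** A path functor on U is what is left of a functor from the fundamental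
    groupoid of U to the one-object groupoid K when only its values on paths are
    kept.  The weight w is defined on all functions, but is constrained only on
    the continuous paths inside U, and the homotopies that count are those that
    stay inside U. *)
Definition homotopy_invariant_on U w : Prop :=
  forall H : prod_cs I I -> X, ccontinuous H -> (forall z, U (H z)) ->
    (forall s, H (I0 R, s) = H (I0 R, I0 R)) ->
    (forall s, H (I1 R, s) = H (I1 R, I0 R)) ->
    w (fun t => H (t, I0 R)) = w (fun t => H (t, I1 R)).

Definition multiplicative_on U w : Prop :=
  forall f g : I -> X, ccontinuous f -> ccontinuous g ->
    (forall t, U (f t)) -> (forall t, U (g t)) -> f (I1 R) = g (I0 R) ->
    w (concat_fun f g) = (w f * w g)%g.

Definition path_functor_on U w : Prop :=
  homotopy_invariant_on U w /\ multiplicative_on U w.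

Lemma row_cts (H : prod_cs I I -> X) (s : I) :
  ccontinuous H -> @ccontinuous I X (fun t => H (t, s)).
Proof.
move=> cH; apply: (ccontinuous_comp _ cH); apply: pair_cts.
  exact: ccontinuous_id.
exact: ccontinuous_cst.
Qed.

Lemma path_functor_ext U w w' :
  (forall f, ccontinuous f -> (forall t, U (f t)) -> w f = w' f) ->
  path_functor_on U w -> path_functor_on U w'.
Proof.
move=> ww' [wh wm]; split=> [H cH HU H0 H1|f g cf cg fU gU fg].
  by rewrite -!ww' ?(wh H)//; exact: row_cts.
rewrite -!ww' ?wm//; first exact: concat_cts.
by move=> t; rewrite /concat_fun; case: ifP.
Qed.

(** A constant path is its own concatenation with itself, and 1 is the only
    idempotent of a group. *)
Lemma path_functor_cst U w y : path_functor_on U w -> U y ->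
  w (fun=> y) = 1%g.
Proof.
move=> [_ wm] Uy; have := wm (fun=> y) (fun=> y).
have -> : concat_fun (fun=> y) (fun=> y) = fun _ : I => y.
  by apply/funext => t; rewrite /concat_fun; case: ifP.
move=> /(_ (ccontinuous_cst _) (ccontinuous_cst _) (fun=> Uy) (fun=> Uy) erefl).
by move=> /esym e; apply: (mulgI (w (fun=> y))); rewrite mulg1.
Qed.

Section convex.
Variables (E : normedModType R) (F : E -> X) (C : set E) (U : set X).
Variable w : (I -> X) -> K.
Hypotheses (wU : path_functor_on U w) (cF : @ccontinuous (top_cs E) X F).
Hypotheses (cC : convex C) (CU : forall z, C z -> U (F z)).

(** The straight-line homotopy between a and b stays in C, so its image stays
    in U. *)
Lemma path_functor_convex (a b : I -> top_cs E) :
  ccontinuous a -> ccontinuous b ->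
  (forall t, C (a t)) -> (forall t, C (b t)) ->
  a (I0 R) = b (I0 R) -> a (I1 R) = b (I1 R) -> w (F \o a) = w (F \o b).
Proof.
move=> ca cb Ca Cb ab0 ab1.
pose H (z : prod_cs I I) := F (seg (a z.1) (b z.1) z.2).
have -> : F \o a = fun t => H (t, I0 R).
  by apply/funext => t; rewrite /H seg0.
have -> : F \o b = fun t => H (t, I1 R).
  by apply/funext => t; rewrite /H seg1.
apply: (wU.1 H) => [|z|s|s].
- have cL := @straight_cts R E (prod_cs I I) (a \o fst) (b \o fst) snd
    (ccontinuous_comp (@fst_cts _ _) ca) (ccontinuous_comp (@fst_cts _ _) cb)
    (@snd_cts _ _).
  exact: (ccontinuous_comp cL cF).
- by apply: CU; apply: seg_in.
- by rewrite /H /= -ab0 /seg /seg_pt subrr !scaler0.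
- by rewrite /H /= -ab1 /seg /seg_pt subrr !scaler0.
Qed.

(** Additivity on segments.  Taking F to be a path on R it expresses subdivision
    of the path; taking F to be a homotopy on R * R it says that the weights of
    the two ways round a small square agree, via its diagonal. *)
Lemma path_functor_seg p q r : C p -> C q -> C r ->
  w (F \o seg p r) = (w (F \o seg p q) * w (F \o seg q r))%g.
Proof.
move=> Cp Cq Cr.
have cs (u v : E) : @ccontinuous I X (F \o seg u v).
  exact: (ccontinuous_comp (@seg_cts R E u v) cF).
have sU (u v : E) : C u -> C v -> forall t, U ((F \o seg u v) t).
  by move=> Cu Cv t; apply: CU; apply: seg_in.
rewrite -wU.2 ?(sU, cs)//; try by apply: sU.
  rewrite -comp_concat; apply: path_functor_convex.
  - exact: seg_cts.
  - by apply: concat_cts; rewrite ?seg1 ?seg0//; exact: seg_cts.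
  - by move=> t; apply: seg_in.
  - by move=> t; rewrite /concat_fun; case: ifP => _; apply: seg_in.
  - by rewrite concat0 !seg0.
  - by rewrite concat1 !seg1.
by rewrite /= seg1 seg0.
Qed.

Lemma path_functor_seg_cst p : C p -> w (F \o seg p p) = 1%g.
Proof.
move=> Cp; rewrite -(@path_functor_cst U w (F p)) ?CU//; last exact: CU.
by congr w; apply/funext => t /=; rewrite /seg /seg_pt subrr scaler0 addr0.
Qed.

End convex.
End on_subset.

Section cover.
Context {X : closureSpace}.
Variables (cov : set (set X)) (w : (I -> X) -> K).
Hypothesis covX : interior_cover cov.
Hypothesis wcov : forall U, cov U -> path_functor_on U w.

(** Replaces the Lebesgue number lemma.  The preimages of the members of the
    cover need not be open, but each point is interior to one of them. *)
Lemma cover_ball (E : normedModType R) (F : E -> X) (x : E) :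
  @ccontinuous (top_cs E) X F ->
  exists2 U, cov U & exists2 e : R, 0 < e & forall z, ball x e z -> U (F z).
Proof.
move=> /ccontinuousP cF; have [U cU /cF /cnbhs_top] := covX (F x).
by move=> /nbhs_ballP[e /= e0 eU]; exists U => //; exists e.
Qed.

Lemma local_cst (y : X) : w (fun=> y) = 1%g.
Proof.
have [U cU /cnbhs_mem Uy] := covX y; exact: path_functor_cst (wcov cU) Uy.
Qed.

(** A primitive is a K-valued antiderivative of w along F: its increments on the
    pieces of F that fit into one member of the cover are the weights of these
    pieces.  It plays the role of the product of the weights of the pieces of a
    subdivision, without mentioning a subdivision. *)
Definition primitive (F : R -> X) (g : R -> K) : Prop :=
  forall (a b : R) U, 0 <= a -> a <= b -> b <= 1 -> cov U ->
    (forall t, a <= t <= b -> U (F t)) -> g b = (g a * w (F \o seg a b))%g.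

Lemma convex_itv (a b : R) : convex [set t : R | a <= t <= b].
Proof.
move=> p q t /= /andP[ap pb] /andP[aq qb] /andP[t0 t1].
by rewrite /seg_pt /GRing.scale /=; apply/andP; split; nra.
Qed.

Lemma ball_itv (x e a b t : R) : ball x e a -> ball x e b -> a <= t <= b ->
  ball x e t.
Proof.
rewrite /ball /= !ltr_distlC => /andP[? ?] /andP[? ?] /andP[? ?].
by apply/andP; split; lra.
Qed.

(** Extend a primitive from [0, a] to [0, b] by the weight of the segment that
    starts at a, when F maps [a, b] into a single U. *)
Lemma primitive_exists (F : R -> X) : @ccontinuous (top_cs R) X F ->
  exists g, g 0 = 1%g /\ primitive F g.
Proof.
move=> cF.
pose P (x : R) := exists g : R -> K, g 0 = 1%g /\
  forall (a b : R) U, 0 <= a -> a <= b -> b <= x -> cov U ->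
    (forall t, a <= t <= b -> U (F t)) -> g b = (g a * w (F \o seg a b))%g.
suff : P 1 by move=> [g [g0 Hg]]; exists g.
apply: real_induction => [|x _].
  exists (fun=> 1%g); split=> // a b U a0 ab b0 cU FU.
  have -> : a = b by lra.
  rewrite (path_functor_seg_cst (wcov cU) (C := [set t : R | a <= t <= b]))//.
    by rewrite mulg1.
  by rewrite /= lexx ab.
have [U cU [e e0 eU]] := cover_ball x cF.
exists e => // a b a0 ab b1 xa xb [g [g0 Hg]].
have cocycle (V : set X) (l r p q s : R) : cov V ->
    (forall t, l <= t <= r -> V (F t)) ->
    l <= p <= r -> l <= q <= r -> l <= s <= r ->
    w (F \o seg p s) = (w (F \o seg p q) * w (F \o seg q s))%g.
  move=> cV lrV lp lq ls.
  exact: (path_functor_seg (wcov cV) cF (@convex_itv l r) lrV).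
exists (fun z => if z <= a then g z else (g a * w (F \o seg a z))%g); split.
  by rewrite a0.
move=> s z V s0 sz zb cV szV.
have abU t : a <= t <= b -> U (F t) by move=> abt; apply/eU/(ball_itv xa xb abt).
(* The new increments over [s, z] are those of the old primitive when z <= a;
   otherwise the cocycle relation gives them, inside V if s <= a < z and inside U
   if a < s. *)
case: (leP z a) => za; first by rewrite (le_trans sz za); exact: (Hg _ _ V).
case: (leP s a) => sa.
  rewrite (Hg s a V) => //; last first.
    by move=> t /andP[st ta]; apply: szV; rewrite st (le_trans ta)// ltW.
  by rewrite -mulgA -(cocycle V s z)//; apply/andP; split; lra.
by rewrite -mulgA -(cocycle U a b)//; apply/andP; split; lra.
Qed.

Lemma primitive_unique (F : R -> X) g g' : @ccontinuous (top_cs R) X F ->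
  primitive F g -> primitive F g' -> g 0 = g' 0 -> g 1 = g' 1.
Proof.
move=> cF pg pg' g0; apply: (real_induction (P := fun t => g t = g' t)) => // x _.
have [U cU [e e0 eU]] := cover_ball x cF.
exists e => // a b a0 ab b1 xa xb gga.
have abU t : a <= t <= b -> U (F t) by move=> abt; apply/eU/(ball_itv xa xb abt).
by rewrite (pg a b U)// (pg' a b U)// gga.
Qed.

Lemma seg_horizontal (a b s : R) (t : I) :
  seg ((a, s) : R * R) (b, s) t = (seg a b t, s).
Proof. by rewrite /seg /seg_pt; congr pair => /=; rewrite subrr scaler0 addr0. Qed.

Lemma seg_vertical (a r s : R) (t : I) :
  seg ((a, r) : R * R) (a, s) t = (a, seg r s t).
Proof. by rewrite /seg /seg_pt; congr pair => /=; rewrite subrr scaler0 addr0. Qed.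

(** G s is the primitive of the row t |-> F (t, s), and its value at 1 is the
    total weight of that row.  For s close to s0, the values G s a and G s0 a
    differ by the weight of the vertical segment between the two rows at a: this
    propagates along a because the small squares commute.  At a = 1 the vertical
    segments are constant, so that G s 1 is locally constant in s. *)
Lemma primitive_homotopy (F : R * R -> X) (G : R -> R -> K) :
  @ccontinuous (top_cs (R * R)%type) X F ->
  (forall s s', F (0, s) = F (0, s')) -> (forall s s', F (1, s) = F (1, s')) ->
  (forall s, G s 0 = 1%g /\ primitive (fun t => F (t, s)) (G s)) ->
  G 0 1 = G 1 1.
Proof.
move=> cF F0 F1 HG.
have loc (s0 : R) : exists2 e : R, 0 < e &
    forall s : R, ball s0 e s -> G s 1 = G s0 1.
  suff : exists2 e : R, 0 < e & forall s, ball s0 e s ->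
     G s 1 = (G s0 1%R * w (F \o seg ((1, s0)%R : R * R) (1, s)%R))%g.
    move=> [e e0 He]; exists e => // s /He ->.
    rewrite -[RHS]mulg1 -(local_cst (F (1, 0))); congr (_ * w _)%g.
    by apply/funext => t /=; rewrite seg_vertical.
  apply: (@real_induction R (fun x => exists2 e : R, 0 < e & forall s,
    ball s0 e s -> G s x = (G s0 x * w (F \o seg ((x, s0) : R * R) (x, s)))%g)).
    exists 1 => // s _; rewrite !(HG _).1 mul1g -(local_cst (F (0, 0))).
    by congr w; apply/funext => t /=; rewrite seg_vertical.
  move=> x _; have [U cU [e e0 eU]] := cover_ball (x, s0) cF.
  exists e => // a b a0 ab b1 xa xb [d d0 Hd].
  exists (Num.min d e); first by rewrite lt_min d0.
  move=> s ds.
  have sd : ball s0 d s by apply: le_ball ds; rewrite ge_min lexx.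
  have se : ball s0 e s by apply: le_ball ds; rewrite ge_min lexx orbT.
  have ss : ball s0 e s0 by apply: ballxx.
  have rowU r : ball s0 e r -> forall t, a <= t <= b -> U (F (t, r)).
    move=> sr t abt; apply: eU; split => //=; exact: ball_itv xa xb abt.
  have rowE r : (fun t : R => F (t, r)) \o seg a b = F \o seg (a, r) (b, r).
    by apply/funext => t /=; rewrite seg_horizontal.
  rewrite ((HG s).2 a b U)// ?((HG s0).2 a b U)//; try exact: rowU.
  rewrite Hd// !rowE -!mulgA; congr (_ * _)%g.
  (* Both sides are the weight of the diagonal of the square with corners
     (a, s0) and (b, s). *)
  have sq := path_functor_seg (wcov cU) cF (@convex_ball _ _ (x, s0) e) eU.
  by rewrite -!sq.
apply: (real_induction (P := fun s => G 0 1 = G s 1)) => // x _.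
have [e e0 He] := loc x; exists e => // a b _ _ _ xa xb ->.
by rewrite (He a)// (He b).
Qed.

(** * Extension of local path functors *)

Lemma extend_cts (f : I -> X) : ccontinuous f ->
  @ccontinuous (top_cs R) X (f \o toI (R := R)).
Proof. by move=> cf; exact: ccontinuous_comp (@toI_cts R) cf. Qed.

(** Paths are turned into maps on R by composing with the retraction toI, so
    that segments of R can be used on them; the segment from 0 to 1 gives the
    path back. *)
Lemma extend_seg (f : I -> X) : (f \o toI (R := R)) \o seg (0 : R) 1 = f.
Proof.
apply/funext => t /=.
by rewrite /seg /seg_pt subr0 add0r [_ *: _]mulr1 valIK.
Qed.

(** Primitives restrict to subpaths, up to left translation by a constant. *)
Lemma primitive_affine (F F' : R -> X) (g : R -> K) (k : K) (c d : R) :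
  0 <= c -> 0 <= d -> c + d <= 1 ->
  (forall t, 0 <= t <= 1 -> F' t = F (c + d * t)) ->
  primitive F g -> primitive F' (fun t => (k * g (c + d * t)%R)%g).
Proof.
move=> c0 d0 cd1 FF' pg a b U a0 ab b1 cU FU.
have cb : c + d * b <= 1 by nra.
have ca : 0 <= c + d * a by nra.
have cab : c + d * a <= c + d * b by nra.
rewrite (pg _ _ U ca cab cb cU) ?mulgA.
  congr (_ * w _)%g; apply/funext => t /=; rewrite FF'.
    by congr F; rewrite /seg /seg_pt /GRing.scale /=; ring.
  have /andP[t0 t1] := valI_itv t.
  by rewrite /seg /seg_pt /GRing.scale /=; apply/andP; split; nra.
move=> t /andP[at_ tb].
(* For d = 0 the parameter t cannot be pulled back to [a, b], but then both
   segments are reduced to a point. *)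
have [d0'|d0'] := eqVneq d 0.
  have -> : t = c + d * a by move: at_ tb; rewrite d0' !mul0r; lra.
  by rewrite -FF'; [apply: FU; rewrite lexx ab|apply/andP; split; lra].
have dp : 0 < d by rewrite lt_def d0' d0.
have tE : t = c + d * ((t - c) / d) by field.
have a_t : a <= (t - c) / d by rewrite ler_pdivlMr//; lra.
have t_b : (t - c) / d <= b by rewrite ler_pdivrMr//; lra.
rewrite tE -FF'; first by apply: FU; rewrite a_t.
by apply/andP; split; lra.
Qed.

Lemma concat_left (f g : I -> X) (t : R) : 0 <= t <= 1 ->
  concat_fun f g (toI (2^-1 * t)) = f (toI t).
Proof.
move=> /andP[t0 t1]; rewrite /concat_fun toIK; last by apply/andP; split; lra.
by rewrite ifT; [congr (f (toI _)); field|lra].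
Qed.

Lemma concat_right (f g : I -> X) (t : R) : f (I1 R) = g (I0 R) ->
  0 <= t <= 1 -> concat_fun f g (toI (2^-1 + 2^-1 * t)) = g (toI t).
Proof.
move=> fg /andP[t0 t1]; rewrite /concat_fun toIK; last by apply/andP; split; lra.
case: ifP => th; last by congr (g (toI _)); field.
have -> : t = 0 by lra.
by rewrite mulr0 addr0 divff ?pnatr_eq0//; exact: fg.
Qed.

(** The extension sends a path to the value at 1 of its primitive that starts
    at 1%g.  The primitive of a concatenation restricts to primitives of its two
    halves, hence multiplicativity; homotopy invariance is primitive_homotopy. *)
Lemma path_functor_extension : exists W : (I -> X) -> K,
  path_functor_on setT W /\
  forall U (f : I -> X), cov U -> ccontinuous f -> (forall t, U (f t)) -> W f = w f.
Proof.
have /choice[G HG] : forall f : I -> X, exists g : R -> K, ccontinuous f ->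
    g 0 = 1%g /\ primitive (f \o toI (R := R)) g.
  move=> f; have [cf|ncf] := pselect (ccontinuous f); last by exists (fun=> 1%g).
  by have [g Hg] := primitive_exists (extend_cts cf); exists g.
exists (fun f => G f 1); split; last first.
  move=> U f cU cf fU; have [g0 pg] := HG f cf.
  by rewrite (pg 0 1 U) ?lexx ?ler01 ?g0 ?mul1g ?extend_seg// => t _; apply: fU.
split=> [H cH _ H0 H1|f g cf cg _ _ fg].
  pose F (z : R * R) := H (toI z.1, toI z.2).
  apply: (primitive_homotopy (F := F)
    (G := fun s => G (fun t => H (t, toI s)))).
  - apply: (ccontinuous_comp _ cH); apply: pair_cts.
      apply: (ccontinuous_comp _ (@toI_cts R)).
      by apply: (@top_cts (R * R)%type R) => z; exact: cvg_fst.
    apply: (ccontinuous_comp _ (@toI_cts R)).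
    by apply: (@top_cts (R * R)%type R) => z; exact: cvg_snd.
  - by move=> s s'; rewrite /F /= H0 [RHS]H0.
  - by move=> s s'; rewrite /F /= H1 [RHS]H1.
  - by move=> s; exact: (HG _ (row_cts cH)).
have cfg := concat_cts cf cg fg.
have [f0 pf] := HG _ cf; have [g0 pg] := HG _ cg; have [h0 ph] := HG _ cfg.
set h := G (concat_fun f g) in h0 ph *.
have -> : G f 1 = h 2^-1.
  have pf' : primitive (f \o toI (R := R)) (fun t => (1 * h (0 + 2^-1 * t)%R)%g).
    apply: primitive_affine ph; [lra|lra|lra|].
    by move=> t t01; rewrite /= add0r concat_left.
  rewrite (primitive_unique (extend_cts cf) pf pf').
    by rewrite mul1g add0r mulr1.
  by rewrite f0 mul1g add0r mulr0 h0.
have -> : G g 1 = ((h 2^-1%R)^-1 * h 1%R)%g.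
  have pg' : primitive (g \o toI (R := R))
      (fun t => ((h 2^-1%R)^-1 * h (2^-1 + 2^-1 * t)%R)%g).
    apply: primitive_affine ph; [lra|lra|lra|].
    by move=> t t01; rewrite /= concat_right.
  rewrite (primitive_unique (extend_cts cg) pg pg').
    by congr (_ * h _)%g; field.
  by rewrite g0 mulr0 addr0 mulVg.
by rewrite mulVKg.
Qed.

(** Real induction on the initial subpaths of f.  For fundamental groups this
    replaces the statement that the loops inside the members of the cover
    generate the group. *)
Lemma path_functor_unique (W W' : (I -> X) -> K) :
  path_functor_on setT W -> path_functor_on setT W' ->
  (forall U (f : I -> X), cov U -> ccontinuous f -> (forall t, U (f t)) ->
     W f = W' f) ->
  forall f, ccontinuous f -> W f = W' f.
Proof.
move=> WT WT' WW f /extend_cts cf; rewrite -(extend_seg f).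
set F := f \o _ in cf *.
have cT : convex [set: R] by [].
have FT (z : R) : [set: R] z -> [set: X] (F z) by [].
apply: (@real_induction R (fun t => W (F \o seg 0 t) = W' (F \o seg 0 t))).
  by rewrite (path_functor_seg_cst WT FT)// (path_functor_seg_cst WT' FT).
move=> x _; have [U cU [e e0 eU]] := cover_ball x cf.
exists e => // a b _ _ _ xa xb WWa.
rewrite (path_functor_seg WT cf cT FT (q := a))//.
rewrite (path_functor_seg WT' cf cT FT (q := a))// WWa; congr (_ * _)%g.
apply: (WW U) => //; first exact: (ccontinuous_comp (@seg_cts R R a b) cf).
by move=> t; apply: eU; apply: seg_in => //; exact: convex_ball.
Qed.

End cover.
End path_functors.

(** * Path functors and homomorphisms out of the fundamental group *)

Section induced.
Context {R : realType}.
Local Notation I := (itvI R).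

Section class_of.
Context {Y : closureSpace} (y : Y).

(** The constant loop is the value at functions that are not loops; this makes
    class_of, and hence the induced weight, a total function of f. *)
Definition loop_of (f : I -> Y) : loop R Y y :=
  if pselect [/\ ccontinuous f, f (I0 R) = y & f (I1 R) = y] is left H
  then let: And3 cf f0 f1 := H in Loop cf f0 f1 else cst_loop.

Lemma loop_ofE f : ccontinuous f -> f (I0 R) = y -> f (I1 R) = y ->
  loop_of f = f :> (I -> Y).
Proof. by move=> cf f0 f1; rewrite /loop_of; case: pselect => [[]|[]]. Qed.

Definition class_of f : pi1 R y := pi1_class (loop_of f).

Lemma class_of_loop (v : loop R Y y) : class_of v = pi1_class v.
Proof.
apply/pi1_classP; rewrite loop_ofE ?loop0 ?loop1//; last exact: loop_cts.
exact: homotopic_refl (loop_cts v).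
Qed.

Lemma class_of_homotopic f g : ccontinuous f -> ccontinuous g ->
  f (I0 R) = y -> f (I1 R) = y -> homotopic_rel f g -> class_of f = class_of g.
Proof.
move=> cf cg f0 f1 fg; apply/pi1_classP; rewrite !loop_ofE//.
- by case: fg => H [_ _ <- Hb]; rewrite (Hb (I1 R)).1.
- by case: fg => H [_ _ <- Hb]; rewrite (Hb (I1 R)).2.
Qed.

Lemma class_of_concat f g : ccontinuous f -> ccontinuous g ->
  f (I0 R) = y -> f (I1 R) = y -> g (I0 R) = y -> g (I1 R) = y ->
  class_of (concat_fun f g) = (class_of f * class_of g)%g.
Proof.
move=> cf cg f0 f1 g0 g1; rewrite [RHS]pi1_mulE; apply/pi1_classP => /=.
have cfg : ccontinuous (concat_fun f g) by apply: concat_cts; rewrite ?f1.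
by rewrite !loop_ofE ?concat0 ?concat1//; exact: homotopic_refl.
Qed.

End class_of.

Lemma homotopic_cancel {Y : closureSpace} (b g : I -> Y) :
  ccontinuous b -> ccontinuous g -> b (I1 R) = g (I0 R) ->
  homotopic_rel (concat_fun (rev_fun b) (concat_fun b g)) g.
Proof.
move=> cb cg bg; have crb := rev_cts cb.
apply: (homotopic_trans (homotopic_concatA crb cb cg (rev1 b) bg)).
have := homotopic_concatV crb; rewrite Defs.revK rev0 bg => bV.
apply: homotopic_trans (homotopic_concat1l cg).
apply: homotopic_concat bV (homotopic_refl cg).
by rewrite concat1.
Qed.

Section functor.
Context {K : groupType} {Y : closureSpace} (y : Y).
Variables (k : pi1 R y -> K) (c : Y -> I -> Y).

(** A path is closed up to a loop at y by means of a fixed system c of paths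
    from y to all points.  Composed with a homomorphism k out of the fundamental
    group, this makes k into a path functor. *)
Definition close_up (f : I -> Y) : I -> Y :=
  concat_fun (c (f (I0 R))) (concat_fun f (rev_fun (c (f (I1 R))))).

Definition induced (f : I -> Y) : K := k (class_of y (close_up f)).

Hypothesis c_cts : forall z, ccontinuous (c z).
Hypothesis c0 : forall z, c z (I0 R) = y.
Hypothesis c1 : forall z, c z (I1 R) = z.

Lemma tail_cts f : ccontinuous f ->
  ccontinuous (concat_fun f (rev_fun (c (f (I1 R))))).
Proof. by move=> cf; apply: concat_cts => //; [exact: rev_cts|rewrite rev0]. Qed.

Lemma close_up_cts f : ccontinuous f -> ccontinuous (close_up f).
Proof.
by move=> cf; apply: concat_cts => //; [exact: tail_cts|rewrite concat0].
Qed.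

Lemma close_up0 f : close_up f (I0 R) = y.
Proof. by rewrite /close_up concat0. Qed.

Lemma close_up1 f : close_up f (I1 R) = y.
Proof. by rewrite /close_up !concat1 rev1. Qed.

Lemma close_up_homotopic f g :
  homotopic_rel f g -> homotopic_rel (close_up f) (close_up g).
Proof.
move=> fg; have [H [_ _ H1 Hb]] := fg.
rewrite /close_up -!H1 !(Hb (I1 R)).1 !(Hb (I1 R)).2.
have cc z := homotopic_refl (@c_cts z).
apply: homotopic_concat => //; first by rewrite concat0 c1.
apply: homotopic_concat => //; first by rewrite rev0 c1.
by apply: homotopic_refl; apply: rev_cts.
Qed.

(** The detour from the middle point to y and back cancels. *)
Lemma close_up_concat f g : ccontinuous f -> ccontinuous g ->
  f (I1 R) = g (I0 R) ->
  homotopic_rel (concat_fun (close_up f) (close_up g))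
                (close_up (concat_fun f g)).
Proof.
move=> cf cg fg.
have ctg := tail_cts cg; have ctf := tail_cts cf.
have crf : ccontinuous (rev_fun (c (f (I1 R)))) by exact: rev_cts.
have crg : ccontinuous (rev_fun (c (g (I1 R)))) by exact: rev_cts.
have cug := close_up_cts cg.
(* Reassociate until the middle factor is the reverse of c (f 1) followed by
   c (f 1), which can be cancelled. *)
apply: (homotopic_trans (homotopic_sym (homotopic_concatA _ _ _ _ _))) => //.
- by rewrite concat0.
- by rewrite !concat1 rev1 close_up0.
rewrite {2}/close_up concat0 concat1.
apply: homotopic_concat (homotopic_refl (@c_cts _)) _.
  by rewrite !concat0 c1.
apply: (homotopic_trans (homotopic_sym (homotopic_concatA _ _ _ _ _))) => //.
- by rewrite rev0.
- by rewrite rev1 close_up0.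
apply: (homotopic_trans _ (homotopic_concatA _ _ _ _ _)) => //; last first.
  by rewrite rev0.
apply: homotopic_concat (homotopic_refl cf) _; first by rewrite concat0 rev0.
rewrite /close_up -fg; apply: homotopic_cancel => //.
by rewrite concat0 c1.
Qed.

Lemma induced_path_functor : {morph k : a b / (a * b)%g} ->
  path_functor_on setT induced.
Proof.
move=> kM; split=> [H cH _ H0 H1|f g cf cg _ _ fg].
  congr k; apply: class_of_homotopic; rewrite ?close_up0 ?close_up1//.
  - exact: close_up_cts (row_cts cH).
  - exact: close_up_cts (row_cts cH).
  - by apply: close_up_homotopic; exists H; split=> // s; rewrite H0 H1.
have cfg := concat_cts cf cg fg.
have [[cuf cug] cufg] := (close_up_cts cf, close_up_cts cg, close_up_cts cfg).
rewrite /induced -kM -class_of_concat ?close_up0 ?close_up1//.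
congr k; apply: class_of_homotopic; rewrite ?close_up0 ?close_up1//.
  by apply: concat_cts => //; rewrite close_up1 close_up0.
exact: homotopic_sym (close_up_concat cf cg fg).
Qed.

(** Since c y is constant, the path functor induced by k remembers k. *)
Lemma induced_loop (v : loop R Y y) : c y = (fun=> y) ->
  induced v = k (pi1_class v).
Proof.
move=> cy; rewrite -class_of_loop; congr k.
have cv := loop_cts v.
apply: class_of_homotopic; rewrite ?close_up0 ?close_up1//.
  exact: close_up_cts.
rewrite /close_up loop0 loop1 cy.
have -> : rev_fun (fun _ : I => y) = fun=> v (I1 R).
  by rewrite loop1.
apply: homotopic_trans (homotopic_concat1r cv).
rewrite -[X in concat_fun (fun=> X)](loop0 v).
have cc : ccontinuous (concat_fun v (fun=> v (I1 R))).
  by apply: concat_cts => //; exact: ccontinuous_cst.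
by have := homotopic_concat1l cc; rewrite concat0.
Qed.

End functor.

(** The map i carries the closed-up path of f to that of i \o f, since it carries
    the paths cY to the paths cZ. *)
Lemma induced_natural {K : groupType} {Y Z : closureSpace} (i : cmap Y Z)
    (y : Y) (z : Z) (iy : i y = z) (k : pi1 R z -> K)
    (cY : Y -> I -> Y) (cZ : Z -> I -> Z) (f : I -> Y) :
  (forall u, ccontinuous (cY u)) -> (forall u, cY u (I0 R) = y) ->
  (forall u, cY u (I1 R) = u) -> (forall u, cZ (i u) = i \o cY u) ->
  ccontinuous f ->
  induced k cZ (i \o f) = induced (k \o pi1_map R i iy) cY f.
Proof.
move=> cc c0 c1 ci cf; congr k; rewrite /class_of pi1_mapE; apply/pi1_classP.
have cu := close_up_cts cc c1 cf.
have E : close_up cZ (i \o f) = i \o close_up cY f.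
  by rewrite /close_up !comp_concat /= !ci.
have ciu : ccontinuous (i \o close_up cY f) := ccontinuous_comp cu (cmap_cts i).
rewrite /= (loop_ofE cu (close_up0 c0 f) (close_up1 c0 f)).
rewrite loop_ofE E//=; first exact: homotopic_refl.
  by rewrite (close_up0 c0).
by rewrite (close_up1 c0).
Qed.

End induced.

(** * Subspaces and the Van Kampen theorem *)

Section subspace.
Context {R : realType} {X : closureSpace}.
Local Notation I := (itvI R).

(** A left inverse of the inclusion, in general not continuous; it only serves
    to read a path inside U as a path of the subspace. *)
Definition retr (U : set X) (u0 : sub_cs U) (z : X) : sub_cs U :=
  if pselect (U z) is left Uz then sub_pt Uz else u0.

Lemma retrK (U : set X) u0 z : U z -> val (@retr U u0 z) = z.
Proof. by move=> Uz; rewrite /retr; case: pselect. Qed.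

Lemma val_retr (U : set X) u0 (z : sub_cs U) : retr u0 (val z) = z.
Proof. by apply: val_inj; rewrite retrK//; exact: set_mem (valP z). Qed.

Lemma retr_cts (Z : closureSpace) (U : set X) (u0 : sub_cs U) (f : Z -> X) :
  ccontinuous f -> (forall t, U (f t)) -> ccontinuous (retr u0 \o f).
Proof.
move=> cf fU; apply: sub_cts.
by rewrite (_ : _ \o _ = f)//; apply/funext => t /=; rewrite retrK.
Qed.

Lemma path_functor_retr {K : groupType} (U : set X) (u0 : sub_cs U)
    (w : (I -> sub_cs U) -> K) :
  path_functor_on setT w -> path_functor_on U (fun f => w (retr u0 \o f)).
Proof.
move=> [wh wm]; split=> [H cH HU H0 H1|f g cf cg fU gU fg].
  apply: (wh (retr u0 \o H)) => //; first exact: retr_cts.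
    by move=> s /=; rewrite H0.
  by move=> s /=; rewrite H1.
by rewrite comp_concat wm//=; [exact: retr_cts|exact: retr_cts|rewrite fg].
Qed.

Section basepoint.
Variables (x : X) (c : X -> I -> X).

Definition basepoint_paths_in (U : set X) : Prop :=
  forall z, U z -> forall t, U (c z t).

Hypothesis c_cts : forall z, ccontinuous (c z).
Hypothesis c0 : forall z, c z (I0 R) = x.
Hypothesis c1 : forall z, c z (I1 R) = z.
Hypothesis cx : c x = fun=> x.

Section one.
Variables (U : set X) (Ux : U x).
Hypothesis cU : basepoint_paths_in U.

Definition sub_paths (z : sub_cs U) : I -> sub_cs U :=
  retr (sub_pt Ux) \o c (val z).

Lemma sub_pathsE (z : sub_cs U) t : val (sub_paths z t) = c (val z) t.
Proof. by rewrite retrK//; apply: cU; exact: set_mem (valP z). Qed.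

Lemma sub_paths_cts z : ccontinuous (sub_paths z).
Proof. by apply: retr_cts => // t; apply: cU; exact: set_mem (valP z). Qed.

Lemma sub_paths0 z : sub_paths z (I0 R) = sub_pt Ux.
Proof. by apply: val_inj; rewrite sub_pathsE c0. Qed.

Lemma sub_paths1 z : sub_paths z (I1 R) = z.
Proof. by apply: val_inj; rewrite sub_pathsE c1. Qed.

Lemma sub_paths_base : sub_paths (sub_pt Ux) = fun=> sub_pt Ux.
Proof. by apply/funext => t; apply: val_inj; rewrite sub_pathsE /= cx. Qed.

Section weight.
Context {K : groupType} (k : pi1 R (sub_pt Ux) -> K).

Definition sub_induced (f : I -> X) : K :=
  induced k sub_paths (retr (sub_pt Ux) \o f).

Lemma sub_induced_path_functor : {morph k : a b / (a * b)%g} ->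
  path_functor_on U sub_induced.
Proof.
move=> kM; apply: path_functor_retr; apply: induced_path_functor => //.
- exact: sub_paths_cts.
- exact: sub_paths0.
- exact: sub_paths1.
Qed.

Lemma sub_induced_loop (v : loop R (sub_cs U) (sub_pt Ux)) :
  sub_induced (sub_val U \o v) = k (pi1_class v).
Proof.
have <- : induced k sub_paths v = k (pi1_class v).
  apply: induced_loop; [exact: sub_paths_cts|exact: sub_paths0|
    exact: sub_paths1|exact: sub_paths_base].
by congr induced; apply/funext => t /=; rewrite val_retr.
Qed.

End weight.

Lemma sub_induced_val {K : groupType} (k : pi1 R x -> K) (f : I -> X) :
  ccontinuous f -> (forall t, U (f t)) ->
  induced k c f =
    sub_induced (k \o pi1_map R (sub_val U) (erefl : sub_val U (sub_pt Ux) = x)) f.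
Proof.
move=> cf fU.
rewrite -[LHS](_ : induced k c (sub_val U \o (retr (sub_pt Ux) \o f)) = _).
  apply: induced_natural.
  - exact: sub_paths_cts.
  - exact: sub_paths0.
  - exact: sub_paths1.
  - by move=> u; apply/funext => t; rewrite /= sub_pathsE.
  - exact: retr_cts.
by congr induced; apply/funext => t /=; rewrite retrK.
Qed.

End one.

(** The weights that are induced on V and on a smaller U agree on paths in U,
    because the paths to the base point are the same in both. *)
Lemma sub_induced_incl {K : groupType} (U V : set X) (UV : U `<=` V)
    (Ux : U x) (Vx : V x) (k : pi1 R (sub_pt Vx) -> K) (f : I -> X) :
  basepoint_paths_in U -> basepoint_paths_in V ->
  ccontinuous f -> (forall t, U (f t)) ->
  sub_induced k f =
    sub_induced (k \o pi1_map R (sub_incl UV) (sub_incl_pt UV Ux Vx)) f.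
Proof.
move=> cU cV cf fU.
rewrite /sub_induced.
rewrite -[retr (sub_pt Vx) \o f](_ : sub_incl UV \o (retr (sub_pt Ux) \o f) = _).
  apply: induced_natural.
  - exact: sub_paths_cts.
  - exact: sub_paths0.
  - exact: sub_paths1.
  - by move=> u; apply/funext => t; apply: val_inj; rewrite /= !sub_pathsE.
  - exact: retr_cts.
by apply/funext => t; apply: val_inj; rewrite /= !retrK//; apply: UV.
Qed.

End basepoint.

(** This is where path-connectedness enters, that of the intersection included:
    one system of paths has to serve for both members of the cover, so a point of
    the intersection must be joined to x inside the intersection. *)
Lemma basepoint_paths_exist (U1 U2 : set X) (x : X) :
  interior_cover [set U1; U2] -> path_connected R (sub_cs U1) ->
  path_connected R (sub_cs U2) -> path_connected R (sub_cs (U1 `&` U2)) ->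
  (U1 `&` U2) x ->
  exists c : X -> I -> X, [/\ [/\ forall z, ccontinuous (c z),
    forall z, c z (I0 R) = x, forall z, c z (I1 R) = z & c x = fun=> x],
    basepoint_paths_in c U1 & basepoint_paths_in c U2].
Proof.
move=> cover pc1 pc2 pc12 Ux.
have sub_path (U : set X) z : path_connected R (sub_cs U) -> U x -> U z ->
    exists f : I -> X, [/\ ccontinuous f, f (I0 R) = x, f (I1 R) = z &
      forall t, U (f t)].
  move=> pcU Ux' Uz; have [f [cf f0 f1]] := pcU (sub_pt Ux') (sub_pt Uz).
  exists (val \o f); split=> /=.
  - exact: (ccontinuous_comp cf (@sub_val_cts X U)).
  - by rewrite f0.
  - by rewrite f1.
  - by move=> t; exact: set_mem (valP (f t)).
suff /choice[c Hc] : forall z, exists f : I -> X, [/\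
    [/\ ccontinuous f, f (I0 R) = x, f (I1 R) = z & z = x -> f = fun=> x],
    U1 z -> forall t, U1 (f t) & U2 z -> forall t, U2 (f t)].
  exists c; split; first split.
  - by move=> z; case: (Hc z) => -[].
  - by move=> z; case: (Hc z) => -[].
  - by move=> z; case: (Hc z) => -[].
  - by case: (Hc x) => -[_ _ _ /(_ erefl)].
  - by move=> z; case: (Hc z).
  - by move=> z; case: (Hc z).
move=> z; have [->|zx] := pselect (z = x).
  by exists (fun=> x); split=> //; split => //; exact: ccontinuous_cst.
have [z1|z1] := pselect (U1 z); have [z2|z2] := pselect (U2 z).
- have [f [? ? ? fU]] := sub_path _ z pc12 Ux (conj z1 z2).
  by exists f; split=> // _ t; case: (fU t).
- by have [f [? ? ? fU]] := sub_path _ z pc1 Ux.1 z1; exists f; split.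
- by have [f [? ? ? fU]] := sub_path _ z pc2 Ux.2 z2; exists f; split.
by have [U [->|->] /cnbhs_mem] := cover z.
Qed.

End subspace.

Theorem theorem4p15 (R : realType) (X : closureSpace) (U1 U2 : set X) (x : X)
    (cover : interior_cover [set U1; U2])
    (pc1 : path_connected R (sub_cs U1))
    (pc2 : path_connected R (sub_cs U2))
    (pc12 : path_connected R (sub_cs (U1 `&` U2)))
    (Ux : (U1 `&` U2) x) :
  let x1 : sub_cs U1 := sub_pt Ux.1 in
  let x2 : sub_cs U2 := sub_pt Ux.2 in
  let x12 : sub_cs (U1 `&` U2) := sub_pt Ux in
  let i1 : cmap (sub_cs (U1 `&` U2)) (sub_cs U1) := sub_incl (@subIsetl X U1 U2) in
  let i2 : cmap (sub_cs (U1 `&` U2)) (sub_cs U2) := sub_incl (@subIsetr X U1 U2) in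
  let j1 : cmap (sub_cs U1) X := sub_val U1 in
  let j2 : cmap (sub_cs U2) X := sub_val U2 in
  is_pushout (pi1_map R i1 (sub_incl_pt _ Ux Ux.1 : i1 x12 = x1))
             (pi1_map R i2 (sub_incl_pt _ Ux Ux.2 : i2 x12 = x2))
             (pi1_map R j1 (erefl : j1 x1 = x))
             (pi1_map R j2 (erefl : j2 x2 = x)).
Proof.
move=> x1 x2 x12 i1 i2 j1 j2; split.
  elim/(@pi1_ind R _ x12) => v /=; rewrite !pi1_mapE; apply/pi1_classP.
  apply: homotopic_refl; exact: loop_cts (map_loop _ (map_loop _ v)).
move=> K k1 k2 k12.
have [c [[cc c0 c1 cx] cU1 cU2]] := basepoint_paths_exist cover pc1 pc2 pc12 Ux.
have cU12 : basepoint_paths_in c (U1 `&` U2).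
  by move=> z [z1 z2] t; split; [exact: cU1|exact: cU2].
pose w1 := sub_induced c k1; pose w2 := sub_induced c k2.
have w12 f : ccontinuous f -> (forall t, (U1 `&` U2) (f t)) -> w1 f = w2 f.
  move=> cf fU; rewrite /w1 /w2.
  rewrite (sub_induced_incl cc c0 c1 (@subIsetl X U1 U2) Ux)//.
  rewrite (sub_induced_incl cc c0 c1 (@subIsetr X U1 U2) Ux)//.
  by congr sub_induced; apply/funext.
have w1P : path_functor_on U1 w1.
  by apply: sub_induced_path_functor => //; exact: gmulfM.
have w2P : path_functor_on U2 w2.
  by apply: sub_induced_path_functor => //; exact: gmulfM.
pose w f := if pselect (forall t, U1 (f t)) then w1 f else w2 f.
have wE1 f : (forall t, U1 (f t)) -> w f = w1 f.
  by rewrite /w; case: pselect.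
have wE2 f : ccontinuous f -> (forall t, U2 (f t)) -> w f = w2 f.
  by move=> cf f2; rewrite /w; case: pselect => // f1; exact: w12.
have wP U : [set U1; U2] U -> path_functor_on U w.
  case=> ->.
    by apply: path_functor_ext w1P => f _ fU; rewrite wE1.
  by apply: path_functor_ext w2P => f cf fU; rewrite wE2.
(* The homomorphism out of the fundamental group of X is the extension W of w,
   restricted to loops. *)
have [W [WP Ww]] := path_functor_extension cover wP.
have WH (v v' : loop R X x) : homotopic_rel v v' -> W v = W v'.
  move=> [H [cH H0 H1 Hb]].
  rewrite (_ : loop_fun v = fun t => H (t, I0 R)); last by apply/funext.
  rewrite (_ : loop_fun v' = fun t => H (t, I1 R)); last by apply/funext.
  by apply: WP.1 => // s; rewrite ?(Hb _).1 ?(Hb _).2.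
pose h (a : pi1 R x) := W (repr a).
have hE v : h (pi1_class v) = W v by apply: WH; exact: repr_class.
have hM : {morph h : a b / (a * b)%g}.
  elim/(@pi1_ind R X x) => v; elim/(@pi1_ind R X x) => u.
  rewrite [(_ * _)%g]pi1_mulE !hE; apply: WP.2 => //.
  - exact: loop_cts.
  - exact: loop_cts.
  - exact: loop10.
pose hh := isMultiplicative.Build _ _ h hM.
pose hm : {multiplicative pi1 R x -> K} := HB.pack h hh.
exists hm; split=> [a|a|h' h'1 h'2 a].
- elim/(@pi1_ind R _ x1): a => v; rewrite /= pi1_mapE hE /=.
  have cv := ccontinuous_comp (loop_cts v) (@sub_val_cts X U1).
  have vU t : U1 ((val \o v) t) by exact: set_mem (valP (v t)).
  by rewrite (Ww U1)//; [rewrite wE1//; exact: sub_induced_loop|left].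
- elim/(@pi1_ind R _ x2): a => v; rewrite /= pi1_mapE hE /=.
  have cv := ccontinuous_comp (loop_cts v) (@sub_val_cts X U2).
  have vU t : U2 ((val \o v) t) by exact: set_mem (valP (v t)).
  by rewrite (Ww U2)//; [rewrite wE2//; exact: sub_induced_loop|right].
- elim/(@pi1_ind R X x): a => v; rewrite [RHS]hE.
  (* Any other solution h' induces a path functor on X, which agrees with W on
     the paths inside U1 or inside U2. *)
  rewrite -(induced_loop h' cc c0 c1 v cx).
  apply: (path_functor_unique cover _ WP _ (loop_cts v)).
    by apply: induced_path_functor => //; exact: gmulfM.
  move=> U f [->|->] cf fU.
    rewrite (Ww U1)//; last by left.
    rewrite wE1// (sub_induced_val cc c0 c1 Ux.1)//.
    by congr sub_induced; apply/funext => a; exact: h'1.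
  rewrite (Ww U2)//; last by right.
  rewrite wE2// (sub_induced_val cc c0 c1 Ux.2)//.
  by congr sub_induced; apply/funext => a; exact: h'2.
Qed.
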